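(* For every positive integer $n$, $$36\sum_{m<n}\widehat{\sigma}(m)\widehat{\sigma}(n-m)=\begin{cases}-3\widehat{\sigma}(n)+3\widetilde{\sigma}_3(n), & \text{if } n \text{ is odd},\\ -3\widehat{\sigma}(n)-5\widetilde{\sigma}_3(n)+4\widetilde{\sigma}_3(n/2), & \text{if } n \text{ is even},\end{cases}$$ where the sum runs over positive integers $m<n$.
   Context: For $s,n\in\mathbb{N}$ (positive integers), $\widetilde{\sigma}_s(n)=\sum_{d\mid n}(-1)^{d-1}d^s$ and $\widehat{\sigma}_s(n)=\sum_{d\mid n}(-1)^{\frac nd-1}d^s$; write $\widehat{\sigma}=\widehat{\sigma}_1$. *)

(* Defs.v *)
From mathcomp Require Import all_boot all_order all_algebra.

Set Implicit Arguments.
Unset Strict Implicit.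
Unset Printing Implicit Defensive.

Import Order.TTheory GRing.Theory Num.Theory.
Local Open Scope ring_scope.

(* Both functions are meant for s, n > 0; [divisors n] lists the positive
   divisors of n when n > 0, and the values at n = 0 are junk. *)
Definition sigma_tilde (s n : nat) : int :=
  \sum_(d <- divisors n) (-1) ^+ d.-1 * d%:Z ^+ s.

Definition sigma_hat (s n : nat) : int :=
  \sum_(d <- divisors n) (-1) ^+ (n %/ d).-1 * d%:Z ^+ s.

(* Main.v *)
Require Import Defs.
From mathcomp Require Import all_boot all_order all_algebra.
From mathcomp Require Import ssrAC zify ring.

Import Order.TTheory GRing.Theory Num.Theory.
Local Open Scope ring_scope.

(** Expanding both factors of the convolution turns it into a sum over the
    positive solutions of a x + b y = n,
      S = sum (-1)^(x + y) a b,
    and such sums obey Liouville's identity: for F even in each argument,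
      sum F(a - b, x + y) - F(a + b, x - y)
    depends only on the degenerate solutions, those with a = b or x = y.  The
    reason is that the shear (a, x, b, y) -> (a, x - y, a + b, y) preserves
    a x + b y and maps the solutions with x > y onto those with a < b, so that
    the generic parts of the two sums cancel (liouville_identity).

    For F(u, v) = u^2 (-1)^v the left-hand side is -4 S, as x + y and x - y
    have the same parity.  The degenerate solutions are indexed by a divisor d
    of n and an integer k, and the sums over k are an alternating sum of signs
    and a sum of squares.  The d^2 contributions cancel and there remains
      12 S = sum_{d | n} 3 d^3 + (-1)^(n/d) (2 d^3 + d)
    (sigma_hat_convolution).  The terms in d make up - sigma_hat 1 n, so only
    the comparison of two sums of cubes of divisors is left.  It holds term by
    term when n is odd.  When n = 2 m the coefficients depend only on the
    parities of d and n/d, and the comparison follows from the bijections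
    between the divisors of m, the divisors d of n with n/d even, and the even
    divisors of n. *)

(** * Solutions of a x + b y = n *)

Lemma big_seq_bij {V : nmodType} {T1 T2 : eqType} {s1 : seq T1} {s2 : seq T2}
    {P1 : pred T1} {P2 : pred T2} (h : T1 -> T2) (g : T2 -> T1) (F : T2 -> V) :
    uniq s1 -> uniq s2 ->
    (forall i, i \in s1 -> P1 i -> [/\ h i \in s2, P2 (h i) & g (h i) = i]) ->
    (forall j, j \in s2 -> P2 j -> [/\ g j \in s1, P1 (g j) & h (g j) = j]) ->
  \sum_(j <- s2 | P2 j) F j = \sum_(i <- s1 | P1 i) F (h i).
Proof.
move=> u1 u2 hP gP.
rewrite -big_filter -[RHS]big_filter -(big_map h predT F); apply: perm_big.
apply: uniq_perm; first exact: filter_uniq.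
  rewrite map_inj_in_uniq ?filter_uniq // => i i'.
  rewrite !mem_filter => /andP[Pi si] /andP[Pi' si'] eq_h.
  by have [_ _ <-] := hP i si Pi; have [_ _ <-] := hP i' si' Pi'; rewrite eq_h.
move=> j; apply/idP/mapP => [|[i]]; rewrite mem_filter => /andP[].
  move=> Pj sj; have [sg Pg <-] := gP j sj Pj.
  by exists (g j); rewrite ?mem_filter ?sg ?Pg ?(gP j sj Pj).
by move=> Pi si ->; have [sh Ph _] := hP i si Pi; rewrite mem_filter sh Ph.
Qed.

Definition factorizations (m : nat) : seq (nat * nat) :=
  [seq (d, (m %/ d)%N) | d <- divisors m].

(** The solutions ((a, x), (b, y)), listed by the value m = a x: in this order
    a sum over them is literally a convolution of sums over divisors. *)
Definition quads (n : nat) : seq ((nat * nat) * (nat * nat)) :=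
  [seq pq | m <- index_iota 1 n,
            pq <- [seq (p, q) | p <- factorizations m,
                                q <- factorizations (n - m)]].

Lemma mem_factorizations m a x :
  (0 < m)%N -> ((a, x) \in factorizations m) = (a * x == m)%N.
Proof.
move=> m_gt0; apply/mapP/eqP => [[d]|ax_m].
  by rewrite -dvdn_divisors // => d_m [-> ->]; rewrite mulnC divnK.
have a_gt0 : (0 < a)%N by move: m_gt0; rewrite -ax_m muln_gt0 => /andP[].
by exists a; rewrite -ax_m ?mulKn // -dvdn_divisors ?ax_m // -ax_m dvdn_mulr.
Qed.

Lemma factorizations_uniq m : uniq (factorizations m).
Proof. by rewrite map_inj_uniq ?divisors_uniq // => d d' []. Qed.

Lemma mem_quads n a x b y :
  (((a, x), (b, y)) \in quads n) =
  [&& 0 < a, 0 < x, 0 < b, 0 < y & a * x + b * y == n]%N.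
Proof.
apply/allpairsPdep/idP => [[m [_ [m_n /allpairsP[[p q] /= [p_m q_m ->]]]]]|].
  case=> ? ?; subst p q; move: m_n p_m q_m; rewrite mem_index_iota.
  move=> /andP[m_gt0 m_n]; rewrite !mem_factorizations ?subn_gt0 //.
  by move=> /eqP ? /eqP ?; apply/and5P; split; nia.
move=> /and5P[a0 x0 b0 y0 /eqP n_def].
have ax_gt0 : (0 < a * x)%N by rewrite muln_gt0 a0.
have ax_n : (a * x < n)%N by rewrite -n_def -[ltnLHS]addn0 ltn_add2l muln_gt0 b0.
exists (a * x)%N, ((a, x), (b, y)); split=> //; first by rewrite mem_index_iota ax_gt0.
apply/allpairsP; exists ((a, x), (b, y)).
by split; rewrite // mem_factorizations ?subn_gt0 //= -n_def addKn.
Qed.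

(** The sublists for distinct m are disjoint because m is recovered as a x. *)
Lemma quads_uniq n : uniq (quads n).
Proof.
apply: allpairs_uniq_dep => [|m _|].
- exact: iota_uniq.
- by apply: allpairs_uniq; rewrite ?factorizations_uniq // => -[? ?] [? ?].
have prod_def m pq : m \in index_iota 1 n ->
    pq \in [seq (p, q) | p <- factorizations m, q <- factorizations (n - m)] ->
    m = (pq.1.1 * pq.1.2)%N.
  rewrite mem_index_iota => /andP[m_gt0 _] /allpairsP[[[a x] q] /= [ax _ ->]] /=.
  by move: ax; rewrite mem_factorizations // => /eqP.
move=> _ _ /allpairsPdep[m [pq [m_n pq_m ->]]] /allpairsPdep[m' [pq' [m'_n pq_m' ->]]].
rewrite /= => eq_pq; rewrite -{pq'}eq_pq in pq_m' *.
by rewrite (prod_def m pq) // -(prod_def m' pq).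
Qed.

Definition quad_sum {V : nmodType} (n : nat) (P : nat -> nat -> nat -> nat -> bool)
    (G : nat -> nat -> nat -> nat -> V) : V :=
  \sum_(q <- quads n | P q.1.1 q.1.2 q.2.1 q.2.2) G q.1.1 q.1.2 q.2.1 q.2.2.

Lemma big_divisors_compl {V : nmodType} {n : nat} (f : nat -> nat -> V) :
  (0 < n)%N ->
  \sum_(d <- divisors n) f d (n %/ d)%N = \sum_(d <- divisors n) f (n %/ d)%N d.
Proof.
move=> n_gt0.
have complP d : d \in divisors n -> true ->
    [/\ (n %/ d)%N \in divisors n, true & (n %/ (n %/ d))%N = d].
  rewrite -!dvdn_divisors // => d_n _; have d_gt0 := dvdn_gt0 n_gt0 d_n.
  split=> //; first by apply/dvdnP; exists d; rewrite mulnC divnK.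
  by rewrite -{1}(divnK d_n) mulKn // divn_gt0 // dvdn_leq.
rewrite (big_seq_bij _ _ _ (divisors_uniq n) (divisors_uniq n) complP complP).
by rewrite big_seq [RHS]big_seq; apply: eq_bigr => d /complP[] // _ _ ->.
Qed.

(** * Liouville's identity *)

Section QuadSum.
Context {V : zmodType} {n : nat}.
Implicit Types (P : nat -> nat -> nat -> nat -> bool).
Implicit Types (G : nat -> nat -> nat -> nat -> V).
Local Notation qsum := (quad_sum n).

Lemma eq_quad_sum P G1 G2 :
  (forall a x b y, P a x b y -> G1 a x b y = G2 a x b y) -> qsum P G1 = qsum P G2.
Proof. by move=> eqG; apply: eq_bigr => -[[a x] [b y]] /eqG. Qed.

Lemma quad_sum_swap P G :
  qsum P G = qsum (fun a x b y => P b y a x) (fun a x b y => G b y a x).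
Proof.
apply: (big_seq_bij (fun q => (q.2, q.1)) (fun q => (q.2, q.1)));
  rewrite ?quads_uniq // => -[[a x] [b y]] /=; rewrite !mem_quads => ? ?;
  by split=> //; lia.
Qed.

Lemma quad_sum_transpose P G :
  qsum P G = qsum (fun a x b y => P x a y b) (fun a x b y => G x a y b).
Proof.
apply: (big_seq_bij (fun q => ((q.1.2, q.1.1), (q.2.2, q.2.1)))
   (fun q => ((q.1.2, q.1.1), (q.2.2, q.2.1))));
  rewrite ?quads_uniq // => -[[a x] [b y]] /=; rewrite !mem_quads => ? ?;
  by split=> //; lia.
Qed.

(** The inverse is (a, x, b, y) -> (a, x + y, b - a, y), and
    a x + b y = a (x - y) + (a + b) y.  Every cancellation in Liouville's
    identity is an instance of this reindexing. *)
Lemma quad_sum_shear G :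
  qsum (fun a x b y => a < b)%N G =
  qsum (fun a x b y => y < x)%N (fun a x b y => G a (x - y)%N (a + b)%N y).
Proof.
apply: (big_seq_bij
   (fun q => ((q.1.1, q.1.2 - q.2.2)%N, (q.1.1 + q.2.1, q.2.2)%N))
   (fun q => ((q.1.1, q.1.2 + q.2.2)%N, (q.2.1 - q.1.1, q.2.2)%N)));
  rewrite ?quads_uniq // => -[[a x] [b y]] /=;
  rewrite !mem_quads => /and5P[a0 x0 b0 y0 /eqP nE] ?; split=> //.
- by apply/and5P; split; nia.
- nia.
- by rewrite subnK 1?ltnW // addKn.
- by apply/and5P; split; nia.
- lia.
- by rewrite addnK subnKC // ltnW.
Qed.

(** When a = b = d the equation reads d (x + y) = n; the index k is y. *)
Lemma quad_sum_eq_left G :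
  qsum (fun a x b y => a == b) G =
  \sum_(d <- divisors n) \sum_(1 <= k < n %/ d) G d (n %/ d - k)%N d k.
Proof.
pose s := [seq (d, k) | d <- divisors n, k <- index_iota 1 (n %/ d)].
transitivity (\sum_(i <- s) G i.1 (n %/ i.1 - i.2)%N i.1 i.2); last first.
  by rewrite big_allpairs_dep.
apply: (big_seq_bij (fun i => ((i.1, n %/ i.1 - i.2)%N, (i.1, i.2)))
  (fun q => (q.1.1, q.2.2)) (fun q => G q.1.1 q.1.2 q.2.1 q.2.2)).
- apply: allpairs_uniq_dep; rewrite ?divisors_uniq //.
    by move=> *; exact: iota_uniq.
  by move=> [? ?] [? ?] _ _ /= [-> ->].
- exact: quads_uniq.
- move=> [d k] /allpairsPdep[d' [k' [d_n]]]; rewrite mem_index_iota.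
  move=> k_n [-> ->] _ /=; split=> //=.
  have n_gt0 : (0 < n)%N by move: k_n; case: (posnP n) => [->|] //; rewrite div0n; lia.
  rewrite -dvdn_divisors // in d_n.
  have /= := divnK d_n; have := dvdn_gt0 n_gt0 d_n; rewrite mem_quads.
  by move: (n %/ d')%N k_n => e k_n d'0 <-; apply/and5P; split; nia.
move=> [[a x] [b y]]; rewrite mem_quads /= => /and5P[a0 x0 b0 y0 /eqP nE] /eqP eqab.
have n_def : n = (a * (x + y))%N by rewrite -nE -eqab mulnDr.
have eE : (n %/ a = x + y)%N by rewrite n_def mulKn.
split=> //; last by rewrite /= eE addnK eqab.
apply/allpairsPdep; exists a, y; split=> //.
  by rewrite -dvdn_divisors n_def ?dvdn_mulr // muln_gt0 a0 addn_gt0 x0.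
by rewrite mem_index_iota eE; lia.
Qed.

(** When x = y it reads (a + b) x = n; the divisor d is a + b rather than x,
    and k is b. *)
Lemma quad_sum_eq_right G :
  (0 < n)%N ->
  qsum (fun a x b y => x == y) G =
  \sum_(d <- divisors n) \sum_(1 <= k < d) G (d - k)%N (n %/ d)%N k (n %/ d)%N.
Proof.
move=> n_gt0; rewrite quad_sum_transpose quad_sum_eq_left.
by rewrite (big_divisors_compl (fun d e => \sum_(1 <= k < e) G (e - k)%N d k d)).
Qed.

Lemma quad_sum_splitl G :
  qsum (fun _ _ _ _ => true) G =
  qsum (fun a x b y => a < b)%N G + qsum (fun a x b y => b < a)%N G
  + qsum (fun a x b y => a == b) G.
Proof.
have mkcond P : qsum P G = \sum_(q <- quads n)
    if P q.1.1 q.1.2 q.2.1 q.2.2 then G q.1.1 q.1.2 q.2.1 q.2.2 else 0.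
  exact: big_mkcond.
rewrite !mkcond -!big_split /=.
by apply: eq_bigr => -[[a x] [b y]] _ /=; case: ltngtP; rewrite ?addr0 ?add0r.
Qed.

Lemma quad_sum_splitr G :
  qsum (fun _ _ _ _ => true) G =
  qsum (fun a x b y => x < y)%N G + qsum (fun a x b y => y < x)%N G
  + qsum (fun a x b y => x == y) G.
Proof.
rewrite quad_sum_transpose quad_sum_splitl.
by congr (_ + _ + _); rewrite [RHS]quad_sum_transpose.
Qed.

(** Swapping the pairs (a, x) and (b, y) shows that the cases a < b and b < a
    contribute equally to the first sum, and x < y and y < x to the second.
    After a shear the first sum is twice the sum of F(b, x) over y < x, and the
    second twice the sum of F(b, x) over a < b, up to degenerate terms.  The sums
    of F(b, x) over b < a and over x < y agree by a further shear, so splitting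
    the full sum of F(b, x) in two ways makes the difference degenerate too. *)
Lemma liouville_identity (F : int -> int -> V) :
    (forall u v, F (- u) v = F u v) -> (forall u v, F u (- v) = F u v) ->
  qsum (fun _ _ _ _ => true) (fun a x b y => F (a%:Z - b%:Z) (x + y)%N)
  - qsum (fun _ _ _ _ => true) (fun a x b y => F (a + b)%N (x%:Z - y%:Z)) =
  qsum (fun a x b y => a == b) (fun a x b y => F 0 (x + y)%N + F b x *+ 2)
  - qsum (fun a x b y => x == y) (fun a x b y => F (a + b)%N 0 + F b x *+ 2).
Proof.
move=> evenl evenr.
have half_left : qsum (fun _ _ _ _ => true) (fun a x b y => F (a%:Z - b%:Z) (x + y)%N)
    = qsum (fun a x b y => y < x)%N (fun a x b y => F b x) *+ 2
      + qsum (fun a x b y => a == b) (fun a x b y => F 0 (x + y)%N).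
  rewrite quad_sum_splitl [X in _ + X + _]quad_sum_swap mulr2n; congr (_ + _ + _).
  - rewrite quad_sum_shear; apply: eq_quad_sum => a x b y lt_yx.
    by rewrite -evenl; congr (F _ _); lia.
  - rewrite quad_sum_shear; apply: eq_quad_sum => a x b y lt_yx.
    by congr (F _ _); lia.
  - by apply: eq_quad_sum => a x b y /eqP ->; rewrite subrr.
have half_right : qsum (fun _ _ _ _ => true) (fun a x b y => F (a + b)%N (x%:Z - y%:Z))
    = qsum (fun a x b y => a < b)%N (fun a x b y => F b x) *+ 2
      + qsum (fun a x b y => x == y) (fun a x b y => F (a + b)%N 0).
  rewrite quad_sum_splitr [X in X + _ + _]quad_sum_swap mulr2n quad_sum_shear.
  congr (_ + _ + _).
  - apply: eq_quad_sum => a x b y lt_yx.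
    by rewrite -evenr; congr (F _ _); lia.
  - apply: eq_quad_sum => a x b y lt_yx.
    by congr (F _ _); lia.
  - by apply: eq_quad_sum => a x b y /eqP ->; rewrite subrr.
have cross : qsum (fun a x b y => b < a)%N (fun a x b y => F b x)
           = qsum (fun a x b y => x < y)%N (fun a x b y => F b x).
  by rewrite quad_sum_swap quad_sum_shear [RHS]quad_sum_swap.
have := etrans (esym (quad_sum_splitl (fun a x b y => F b x)))
               (quad_sum_splitr (fun a x b y => F b x)).
rewrite cross half_left half_right.
have -> : qsum (fun a x b y => a == b) (fun a x b y => F 0 (x + y)%N + F b x *+ 2)
   = qsum (fun a x b y => a == b) (fun a x b y => F 0 (x + y)%N)
   + qsum (fun a x b y => a == b) (fun a x b y => F b x) *+ 2.
  by rewrite /quad_sum big_split sumrMnl.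
have -> : qsum (fun a x b y => x == y) (fun a x b y => F (a + b)%N 0 + F b x *+ 2)
   = qsum (fun a x b y => x == y) (fun a x b y => F (a + b)%N 0)
   + qsum (fun a x b y => x == y) (fun a x b y => F b x) *+ 2.
  by rewrite /quad_sum big_split sumrMnl.
move: (qsum (fun a x b y => a < b)%N _) (qsum (fun a x b y => x < y)%N _)
  (qsum (fun a x b y => y < x)%N _) => A B C.
move: (qsum _ (fun a x b y => F b x)) (qsum _ (fun a x b y => F b x)) => E D.
move: (qsum _ _) (qsum _ _) => M N.
(* e compares the two ways of splitting the full sum of F(b, x); it gives
   C - A = D - E, where D and E are its sums over a = b and over x = y. *)
rewrite [A + B]addrC => e.
have -> : D = C + E - A.
  by rewrite -[C + E](addKr B) [B + _]addrA -e -addrA addKr addrAC subrr add0r.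
rewrite mulrnBl mulrnDl; move: (C *+ 2) (E *+ 2) (A *+ 2) => C2 E2 A2.
by rewrite !opprD !addrA [RHS](ACl (2*1*4*5*3*6)) /= addrK.
Qed.

End QuadSum.

(** * The convolution as a sum over divisors *)

Lemma sum_sign_rev e : (0 < e)%N ->
  2 * \sum_(1 <= k < e) (-1) ^+ (e - k) = - (1 + (-1) ^+ e) :> int.
Proof.
rewrite big_nat_rev /=.
under eq_big_nat => k /andP[k_gt0 k_e].
  rewrite (_ : e - _ = k)%N; last by lia.
over.
case: e => // e _; elim: e => [|e IHe]; first by rewrite big_geq // expr1 mulr0 subrr oppr0.
by rewrite big_nat_recr //= mulrDr IHe !exprS; ring.
Qed.

Lemma sum_sqr d : (0 < d)%N ->
  6 * \sum_(1 <= k < d) k%:Z ^+ 2 = 2 * d%:Z ^+ 3 - 3 * d%:Z ^+ 2 + d%:Z.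
Proof.
case: d => // d _; elim: d => [|d IHd]; first by rewrite big_geq.
by rewrite big_nat_recr //= mulrDr IHd -[d.+2]addn1 -[d.+1]addn1 !PoszD; ring.
Qed.

Lemma sign_pred {R : pzRingType} k : (0 < k)%N -> (-1) ^+ k.-1 = - (-1) ^+ k :> R.
Proof. by case: k => // k _; rewrite exprS mulN1r opprK. Qed.

Lemma sigma_hat_convolution_quads n :
  \sum_(1 <= m < n) sigma_hat 1 m * sigma_hat 1 (n - m) =
  quad_sum n (fun _ _ _ _ => true)
    (fun a x b y => (-1) ^+ (x + y)%N * (a%:Z * b%:Z)).
Proof.
transitivity (\sum_(q <- quads n)
   ((-1) ^+ q.1.2.-1 * q.1.1%:Z) * ((-1) ^+ q.2.2.-1 * q.2.1%:Z)).
  rewrite big_allpairs_dep; apply: eq_bigr => m _.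
  rewrite big_allpairs big_map /= mulr_suml; apply: eq_bigr => a _.
  by rewrite big_map mulr_sumr; apply: eq_bigr => b _; rewrite !expr1.
rewrite /quad_sum big_seq [RHS]big_seq; apply: eq_bigr => -[[a x] [b y]].
rewrite mem_quads => /and5P[_ x_gt0 _ y_gt0 _] /=.
by rewrite !sign_pred // exprD; ring.
Qed.

(** Liouville's identity for F(u, v) = u^2 (-1)^v: the squares reduce to
    (a - b)^2 - (a + b)^2 = - 4 a b because the two signs are equal. *)
Lemma sigma_hat_convolution n : (0 < n)%N ->
  12 * \sum_(1 <= m < n) sigma_hat 1 m * sigma_hat 1 (n - m) =
  \sum_(d <- divisors n)
     (3 * d%:Z ^+ 3 + (-1) ^+ (n %/ d) * (2 * d%:Z ^+ 3 + d%:Z)).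
Proof.
move=> n_gt0; pose F (u v : int) : int := u ^+ 2 * (-1) ^+ `|v|%N.
have evenl u v : F (- u) v = F u v by rewrite /F sqrrN.
have evenr u v : F u (- v) = F u v by rewrite /F abszN.
have := liouville_identity (n := n) F evenl evenr.
rewrite quad_sum_eq_left quad_sum_eq_right // -sumrB.
rewrite /quad_sum -sumrB sigma_hat_convolution_quads => eqL.
have eqS : - 4 * quad_sum n (fun _ _ _ _ => true)
    (fun a x b y => (-1) ^+ (x + y)%N * (a%:Z * b%:Z)) =
  \sum_(d <- divisors n)
    (\sum_(1 <= k < n %/ d) (F 0 (n %/ d - k + k)%N + F d (n %/ d - k)%N *+ 2)
     - \sum_(1 <= k < d) (F (d - k + k)%N 0 + F k (n %/ d)%N *+ 2)).
  rewrite -{}eqL mulr_sumr; apply: eq_bigr => -[[a x] [b y]] _; rewrite /F /=.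
  have -> : (-1) ^+ `|x%:Z - y%:Z|%N = (-1) ^+ (x + y)%N :> int.
    by rewrite -signr_odd -[RHS]signr_odd; congr (_ ^+ nat_of_bool _); lia.
  by rewrite PoszD; ring.
rewrite (_ : 12%R = - 3%R * - 4%R) // -mulrA eqS mulr_sumr.
rewrite big_seq [RHS]big_seq; apply: eq_bigr => d; rewrite -dvdn_divisors // => d_n.
have d_gt0 := dvdn_gt0 n_gt0 d_n.
have : (0 < n %/ d)%N by rewrite divn_gt0 // dvdn_leq.
move: (n %/ d)%N => e e_gt0.
have -> : \sum_(1 <= k < e) (F 0 (e - k + k)%N + F d (e - k)%N *+ 2)
    = - d%:Z ^+ 2 * (1 + (-1) ^+ e).
  rewrite mulNr -mulrN -sum_sign_rev // mulrA mulr_sumr; apply: eq_bigr => k _.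
  by rewrite /F; ring.
have -> : \sum_(1 <= k < d) (F (d - k + k)%N 0 + F k e *+ 2)
    = (d%:Z - 1) * d%:Z ^+ 2 + 2 * (-1) ^+ e * \sum_(1 <= k < d) k%:Z ^+ 2.
  rewrite big_split /= mulr_sumr; congr (_ + _); last first.
    by apply: eq_bigr => k _; rewrite /F; ring.
  under eq_big_nat => k /andP[_ /ltnW le_kd].
    rewrite subnK // /F expr0 mulr1.
  over.
  by rewrite sumr_const_nat -mulr_natl natrB // natz.
have := sum_sqr d d_gt0; move: (\sum_(1 <= k < d) _) => s sE.
(* Collecting terms isolates 6 * s, the multiple known without division. *)
rewrite [LHS](_ : _ = 3 * d%:Z ^+ 3 + (-1) ^+ e * (3 * d%:Z ^+ 2 + 6 * s)); last by ring.
by rewrite sE; ring.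
Qed.

(** * Divisors of an even number *)

Lemma mem_divisors_half {m d : nat} :
  (0 < m)%N -> (d \in divisors m) = (d \in divisors m.*2) && ~~ odd (m.*2 %/ d).
Proof.
move=> m_gt0; rewrite -!dvdn_divisors ?double_gt0 //.
apply/idP/andP => [/dvdnP[k mE]|[/dvdnP[k mE]]].
  have d_gt0 : (0 < d)%N by move: m_gt0; rewrite mE muln_gt0 => /andP[].
  by rewrite mE doubleMl dvdn_mull // mulnK // odd_double.
have d_gt0 : (0 < d)%N by move: m_gt0; rewrite -double_gt0 mE muln_gt0 => /andP[].
rewrite mE mulnK // => even_k; apply/dvdnP; exists k./2.
by apply: double_inj; rewrite mE doubleMl even_halfK.
Qed.

Lemma big_divisors_half {V : nmodType} (f : nat -> V) m : (0 < m)%N ->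
  \sum_(d <- divisors m.*2 | ~~ odd (m.*2 %/ d)) f d = \sum_(d <- divisors m) f d.
Proof.
move=> m_gt0; apply: (big_seq_bij id id); rewrite ?divisors_uniq //.
- by move=> d; rewrite (mem_divisors_half m_gt0) => /andP[].
- by move=> d d_m od; rewrite (mem_divisors_half m_gt0) d_m.
Qed.

Lemma big_divisors_double {V : nmodType} (f : nat -> V) m : (0 < m)%N ->
  \sum_(d <- divisors m.*2 | ~~ odd d) f d = \sum_(d <- divisors m) f d.*2.
Proof.
move=> m_gt0; apply: (big_seq_bij double half); rewrite ?divisors_uniq //.
- move=> d; rewrite -!dvdn_divisors ?double_gt0 // => d_m _.
  by rewrite odd_double doubleK -!muln2 dvdn_mul.
- move=> d; rewrite -!dvdn_divisors ?double_gt0 // => d_m even_d.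
  rewrite even_halfK //; split=> //.
  by rewrite -(@dvdn_pmul2r 2) // !muln2 even_halfK.
Qed.

(** * The convolution formula *)

Theorem theorem4p2 (n : nat) (n_gt0 : (0 < n)%N) :
  36 * \sum_(1 <= m < n) sigma_hat 1 m * sigma_hat 1 (n - m) =
  if odd n then - 3 * sigma_hat 1 n + 3 * sigma_tilde 3 n
  else - 3 * sigma_hat 1 n - 5 * sigma_tilde 3 n + 4 * sigma_tilde 3 n./2.
Proof.
have conv36 : 36 * \sum_(1 <= m < n) sigma_hat 1 m * sigma_hat 1 (n - m) =
   - 3 * sigma_hat 1 n
   + \sum_(d <- divisors n) (9 + 6 * (-1) ^+ (n %/ d)) * d%:Z ^+ 3.
  rewrite (_ : 36%R = 3%R * 12%R) // -mulrA sigma_hat_convolution //.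
  rewrite !mulr_sumr -big_split /= big_seq [RHS]big_seq; apply: eq_bigr => d.
  rewrite -dvdn_divisors // => d_n.
  have d_gt0 := dvdn_gt0 n_gt0 d_n.
  have e_gt0 : (0 < n %/ d)%N by rewrite divn_gt0 // dvdn_leq.
  rewrite (sign_pred _ e_gt0) [d%:Z ^+ 1]expr1.
  by move: (n %/ d)%N => e; ring.
rewrite {}conv36; case: ifP => [odd_n|/negbT even_n].
  congr (_ + _); rewrite mulr_sumr big_seq [RHS]big_seq; apply: eq_bigr => d.
  rewrite -dvdn_divisors // => d_n; have := divnK d_n => nE.
  move: odd_n; rewrite -nE oddM => /andP[odd_e odd_d].
  rewrite nE sign_pred ?(dvdn_gt0 n_gt0) // -signr_odd odd_e.
  by rewrite -(signr_odd _ d) odd_d; ring.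
rewrite -addrA; congr (_ + _).
have [m m_gt0 nE] : exists2 m, (0 < m)%N & n = m.*2.
  by exists n./2; rewrite ?even_halfK // half_gt0; case: n n_gt0 even_n => [|[]].
rewrite {n n_gt0 even_n}nE doubleK.
(* The weights are chosen so that, as d and n/d are not both odd, the
   coefficients agree on each parity class of (d, n/d).  Once pulled back to the
   divisors of m, the second sum becomes 2 * 2^3 = 16 times the sum of cubes and
   cancels the constant weight in the first; what is left is 4 * sigma_tilde 3 m. *)
transitivity (- 5 * sigma_tilde 3 m.*2
   + (\sum_(d <- divisors m.*2 | ~~ odd (m.*2 %/ d)) (16 - 4 * (-1) ^+ d) * d%:Z ^+ 3
   - 2 * \sum_(d <- divisors m.*2 | ~~ odd d) d%:Z ^+ 3)).
  rewrite [X in _ + (X - _)]big_mkcond [X in _ - 2 * X]big_mkcond /sigma_tilde.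
  rewrite !mulr_sumr -sumrB -big_split /=.
  rewrite big_seq [RHS]big_seq; apply: eq_bigr => d.
  rewrite -dvdn_divisors ?double_gt0 // => d_n; have := divnK d_n => nE.
  have d_gt0 : (0 < d)%N by apply: dvdn_gt0 d_n; rewrite double_gt0.
  have := odd_double m; rewrite -{1}nE oddM.
  rewrite (sign_pred d) // -(signr_odd _ (_ %/ d)) -(signr_odd _ d).
  by case: (odd _); case: (odd _) => // _ /=; move: (d%:Z ^+ 3) => D; ring.
congr (_ + _); first by rewrite mulNr.
rewrite big_divisors_half // big_divisors_double // !mulr_sumr -sumrB.
rewrite big_seq [RHS]big_seq; apply: eq_bigr => d.
rewrite -dvdn_divisors // => d_m.
by rewrite sign_pred ?(dvdn_gt0 m_gt0) // -muln2 PoszM; ring.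
Qed.
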